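(* Let $$\eta_{n,k}=\tfrac12\bigl(\delta_{k,\lfloor(n+1)/2\rfloor}+\delta_{k,\lceil(n+1)/2\rceil}\bigr)\qquad(n\ge1,\ 1\le k\le n).$$ Then, for any choice of the probabilities $(p_n)_{n\ge1}$, the resulting function $F$ satisfies $$F(v)\le F'(0)\,v\qquad\text{for all }v\in[0,1].$$ Moreover, in this case $$F'(0)=\sum_{n\ge1}p_n\left(2^{1-n}\lceil n/2\rceil\binom{n}{\lfloor n/2\rfloor}\right),$$ and, if there is some $n\ge3$ with $p_n>0$, then $F'(0)>1$ and $\Xi_F=1$.
   Context: Here $p_n\ge0$ with $\sum_{n\ge1}p_n=1$, $\delta_{i,j}$ is the Kronecker delta, and $$F(u)=\sum_{n\ge1}2^{1-n}p_n\sum_{k=1}^n\eta_{n,k}\sum_{j=k}^n\binom nj(1+u)^j(1-u)^{n-j}-1,\qquad u\in[-1,1].$$ (Equivalently, $F(u)=2\sum_{n\ge1} p_n\sum_{k=1}^n\eta_{n,k}P(X_n\ge k)-1$ with $X_n\sim\mathrm{Bin}(n,\frac{1+u}2)$; this choice of $\eta_{n,k}$ corresponds to majority voting among $n$ children with ties broken by a fair coin flip.) For this choice of $\eta_{n,k}$ the function $F$ is odd. One sets $\Xi_F:=\inf\{v>0: F(v)\le v\}$. *)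

(* Defs.v *)
From HB Require Import structures.
From mathcomp Require Import all_boot all_order all_algebra.
From mathcomp Require Import all_classical all_reals all_analysis.

Set Implicit Arguments.
Unset Strict Implicit.
Unset Printing Implicit Defensive.

Import Order.TTheory GRing.Theory Num.Theory.
Import numFieldNormedType.Exports.

Local Open Scope classical_set_scope.
Local Open Scope ring_scope.

(* The values p 0 and eta n k with k = 0 or k > n are never used, and the
   series is only meant for u in [-1, 1]. *)
Definition branching_fun (R : realType) (p : nat -> R) (eta : nat -> nat -> R)
    (u : R) : R :=
  \big[+%R/0]_(1 <= n <oo)
     (2 ^- n.-1 * p n *
      \sum_(1 <= k < n.+1)
        (eta n k *
         \sum_(k <= j < n.+1)
           ('C(n, j)%:R * (1 + u) ^+ j * (1 - u) ^+ (n - j)))) - 1.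

(* floor ((n + 1) / 2) is n.+1./2 and ceil ((n + 1) / 2) is uphalf n.+1. *)
Definition majority_eta (R : realType) (n k : nat) : R :=
  2^-1 * ((k == n.+1./2)%:R + (k == uphalf n.+1)%:R).

(* A probability on n >= 1.  The terms being nonnegative, the extended-real sum
   always exists, so that being equal to 1 includes convergence. *)
Definition is_offspring_law (R : realType) (p : nat -> R) : Prop :=
  (forall n, (1 <= n)%N -> 0 <= p n) /\
  (\sum_(1 <= n <oo) (p n)%:E = 1)%E.

(* Derivatives with values in the extended reals: F'(0) is +oo when
   \sum_n p_n sqrt(n) diverges, a case in which the library's real-valued
   derive1 has no meaning. *)
Definition diff_quotient (R : realType) (f : R -> R) (a h : R) : \bar R :=
  (h^-1 *: (f (h + a) - f a))%:E.

Definition ederivable1 (R : realType) (f : R -> R) (a : R) : Prop :=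
  cvg (diff_quotient f a @ 0^').

Definition ederive1 (R : realType) (f : R -> R) (a : R) : \bar R :=
  lim (diff_quotient f a @ 0^').

Lemma ederive1_fin_num (R : realType) (f : R -> R) (a l : R) :
  (ederivable1 f a /\ ederive1 f a = l%:E) <->
  (derivable f a 1 /\ derive1 f a = l).
Proof.
pose q h : R := h^-1 *: (f (h + a) - f a).
have qE : (fun h : R => h^-1 *: ((f \o shift a) (h *: 1) - f a)) = q.
  by apply/funext => h; rewrite /q /= [h%:A]mulr1.
rewrite /derivable qE /derive1 -/q /ederivable1 /ederive1.
have dqE : diff_quotient f a = EFin \o q by [].
rewrite dqE; split => -[cq lq].
- have /fine_cvg qfl : (EFin \o q) h @[h --> 0^'] --> l%:E by rewrite -lq.
  have ql : q @ 0^' --> l by [].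
  by split; [apply/cvg_ex; exists l|exact: cvg_lim ql].
- have ql : q @ 0^' --> l by rewrite -lq.
  have eql : (EFin \o q) h @[h --> 0^'] --> l%:E.
    by apply: cvg_comp ql _; exact: cvg_id.
  by split; [apply/cvg_ex; exists l%:E|exact: cvg_lim eql].
Qed.

Definition Xi (R : realType) (F : R -> R) : R :=
  inf [set v : R | 0 < v <= 1 /\ F v <= v].

(* Main.v *)
(* For a majority vote among n = 2m+1 or n = 2m+2 children, Pascal's rule gives
   by induction on m that the n-th term of F + 1 is p_n (1 + u S_m(1 - u^2)),
   where S_m(x) = sum_{i <= m} C(2i, i) (x/4)^i has nonnegative coefficients.
   Hence F(u) / u = sum_n p_n S_m(1 - u^2), which increases to
   sum_n p_n S_m(1) = F'(0) as |u| decreases to 0, is at least 1, and is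
   strictly larger than 1 for |u| < 1 as soon as some n >= 3 has p_n > 0. *)
Require Import Defs.
From HB Require Import structures.
From mathcomp Require Import all_boot all_order all_algebra.
From mathcomp Require Import all_classical all_reals all_analysis.
From mathcomp Require Import ring lra zify.

Import Order.TTheory GRing.Theory Num.Theory.
Import numFieldNormedType.Exports.

Local Open Scope classical_set_scope.
Local Open Scope ring_scope.

(** * Unnormalised binomial tails: (a + b)^n times a tail probability *)

Definition binom_tail {A : pzSemiRingType} (a b : A) (n k : nat) : A :=
  \sum_(k <= j < n.+1) ('C(n, j)%:R * a ^+ j * b ^+ (n - j)).

Lemma binom_tail_first (A : pzSemiRingType) (a b : A) (n k : nat) : (k <= n)%N ->
  binom_tail a b n k = 'C(n, k)%:R * a ^+ k * b ^+ (n - k) + binom_tail a b n k.+1.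
Proof. by move=> kn; rewrite /binom_tail big_ltn. Qed.

(** Condition on the last of n+1 trials: more than k successes occur either already among the first
    n, or through exactly k there followed by a success. *)
Lemma binom_tailS (A : comPzRingType) (a b : A) (n k : nat) : (k <= n)%N ->
  binom_tail a b n.+1 k.+1 =
  (a + b) * binom_tail a b n k.+1 + 'C(n, k)%:R * a ^+ k.+1 * b ^+ (n - k).
Proof.
move=> kn.
have -> : binom_tail a b n.+1 k.+1 =
    b * binom_tail a b n k.+1 + a * binom_tail a b n k.
  (* The added term j = n+1 vanishes because C(n, n+1) = 0; it makes the summation ranges agree
     after the shift. *)
  have -> : binom_tail a b n k.+1 =
      \sum_(k.+1 <= j < n.+2) 'C(n, j)%:R * a ^+ j * b ^+ (n - j).
    by rewrite [RHS]big_nat_recr //= bin_small // !mul0r addr0.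
  rewrite /binom_tail !big_add1 /= !mulr_sumr -big_split /=.
  rewrite !big_nat; apply: eq_bigr => j /andP[_ jn].
  rewrite binS natrD mulrDl mulrDl; congr (_ + _); last first.
    by rewrite exprS subSS; ring.
  (* At j = n the truncated exponent n - (j+1) is off by one, but its coefficient C(n, n+1) is
     zero. *)
  have [->|jn'] := eqVneq j n; first by rewrite bin_small // !(mul0r, mulr0).
  have -> : (n.+1 - j.+1 = (n - j.+1).+1)%N by lia.
  by rewrite (exprS b); ring.
by rewrite (binom_tail_first _ a b n k kn) exprS; ring.
Qed.

Lemma binom_tail0 (A : comPzSemiRingType) (a b : A) (n : nat) :
  binom_tail a b n 0 = (a + b) ^+ n.
Proof.
rewrite /binom_tail big_mkord addrC exprDn; apply: eq_bigr => i _.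
by rewrite -mulrA mulr_natl (mulrC (a ^+ i)).
Qed.

Lemma binom_tail_bounds (R : numDomainType) (a b : R) (n k : nat) :
  0 <= a -> 0 <= b -> 0 <= binom_tail a b n k <= (a + b) ^+ n.
Proof.
move=> a0 b0.
have t0 j : 0 <= 'C(n, j)%:R * a ^+ j * b ^+ (n - j).
  by rewrite !mulr_ge0 ?exprn_ge0.
apply/andP; split; first exact: sumr_ge0.
rewrite -binom_tail0 /binom_tail.
have [kn|nk] := leqP k n.+1; last by rewrite big_geq ?sumr_ge0 // ltnW.
by rewrite (@big_cat_nat _ _ _ k 0) //= lerDr sumr_ge0.
Qed.

(** * The sums S_m: partial sums of the power series of (1 - x)^(-1/2) *)

Definition central_sum {R : fieldType} (m : nat) (x : R) : R :=
  \sum_(i < m.+1) 'C(i.*2, i)%:R * (x / 4) ^+ i.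

Lemma central_sumS (R : fieldType) (m : nat) (x : R) :
  central_sum m.+1 x = central_sum m x + 'C(m.+1.*2, m.+1)%:R * (x / 4) ^+ m.+1.
Proof. by rewrite /central_sum big_ord_recr. Qed.

Lemma bin_odd_sym (m : nat) : 'C(m.*2.+1, m.+1) = 'C(m.*2.+1, m).
Proof.
have mn : (m <= m.*2.+1)%N by lia.
by have := bin_sub mn; have -> : (m.*2.+1 - m = m.+1)%N by lia.
Qed.

Lemma bin_central (m : nat) : 'C(m.+1.*2, m.+1) = ('C(m.*2.+1, m)).*2.
Proof.
by rewrite doubleS binS bin_odd_sym addnn.
Qed.

(** * Majority tails for even and odd numbers of voters *)

Section majority.
Variables (R : numFieldType) (u : R).
Let W := binom_tail (1 + u) (1 - u).

Let ab : (1 + u) + (1 - u) = 2 :> R. Proof. by ring. Qed.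

(** A fair tie-break among 2m+2 voters amounts to ignoring one of them. The two boundary terms are
    C(2m+1, m) a^(m+1) b^m times b and times a, and they combine through a + b = 2. *)
Lemma binom_tail_tie (m : nat) :
  W m.+1.*2 m.+1 + W m.+1.*2 m.+2 = 4 * W m.*2.+1 m.+1.
Proof.
rewrite doubleS /W (binom_tailS _ _ _ m.*2.+1 m)
  ?(binom_tailS _ _ _ m.*2.+1 m.+1) ?ab; [|lia..].
rewrite (binom_tail_first _ _ _ m.*2.+1 m.+1); last by lia.
rewrite bin_odd_sym.
have -> : (m.*2.+1 - m = m.+1)%N by lia.
have -> : (m.*2.+1 - m.+1 = m)%N by lia.
by rewrite !exprS; ring.
Qed.

(** Adding two voters multiplies the tail by 4 and adds C(2m+2, m+1) (ab)^(m+1) (a - 1), where a = 1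
    + u and b = 1 - u. Since ab = 1 - u^2 and a - 1 = u, this is exactly the new term of u S_(m+1),
    scaled by 4^(m+1). *)
Lemma binom_tail_majority (m : nat) :
  W m.*2.+1 m.+1 = 4 ^+ m * (1 + u * central_sum m (1 - u ^+ 2)).
Proof.
elim: m => [|m IH].
  rewrite /W /binom_tail big_nat1 /central_sum big_ord1 /= bin0 binn !expr0 expr1; ring.
have -> : W m.+1.*2.+1 m.+2 = 2 * W m.+1.*2 m.+2
    + 'C(m.+1.*2, m.+1)%:R * (1 + u) ^+ m.+2 * (1 - u) ^+ m.+1.
  rewrite /W (binom_tailS _ _ _ m.+1.*2) ?ab; last by lia.
  by have -> : (m.+1.*2 - m.+1 = m.+1)%N by lia.
have := binom_tail_tie m.
rewrite {1}/W (binom_tail_first _ _ _ m.+1.*2 m.+1); last by lia.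
have -> : (m.+1.*2 - m.+1 = m.+1)%N by lia.
rewrite central_sumS -/W => tie.
have -> : 2 * W m.+1.*2 m.+2 = 4 * W m.*2.+1 m.+1
    - 'C(m.+1.*2, m.+1)%:R * (1 + u) ^+ m.+1 * (1 - u) ^+ m.+1.
  by rewrite -tie; ring.
rewrite IH exprMn exprVn.
have -> : 1 - u ^+ 2 = (1 + u) * (1 - u) by ring.
rewrite exprMn (exprS _ m.+1) (exprS 4 m).
by field; rewrite expf_neq0 // pnatr_eq0.
Qed.

End majority.

(** * Value at 1, lower bounds, monotonicity and continuity of S_m *)

Lemma central_sum1 (R : numFieldType) (n : nat) : (0 < n)%N ->
  central_sum n.-1./2 1 = 2 ^- n.-1 * (uphalf n)%:R * 'C(n, n./2)%:R :> R.
Proof.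
have odd_case m : central_sum m 1 = 4 ^- m * m.+1%:R * 'C(m.*2.+1, m)%:R :> R.
  elim: m => [|m IH].
    by rewrite /central_sum big_ord1 !bin0 !expr0 invr1 !mulr1.
  rewrite central_sumS IH bin_central.
  (* Absorption gives (m+2) C(2m+3, m+1) = (2m+3) C(2m+2, m+1), and the last binomial is 2 C(2m+1,
     m). *)
  have E : (m.+2 * 'C(m.+1.*2.+1, m.+1) = 2 * (2 * m + 3) * 'C(m.*2.+1, m))%N.
    have := mul_bin_down m.+1.*2.+1 m.+1; rewrite bin_central /=; lia.
  have {}E : m.+2%:R * 'C(m.+1.*2.+1, m.+1)%:R =
      2 * (2 * m%:R + 3) * 'C(m.*2.+1, m)%:R :> R.
    by rewrite -natrM E !natrM natrD natrM.
  rewrite -[RHS]mulrA E -(mul2n 'C(_, _)) natrM -natr1 exprS div1r exprVn exprS.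
  by field; rewrite expf_neq0 // pnatr_eq0.
case: n => [//|n _].
have pow4 m : 4 ^+ m = 2 ^+ m.*2 :> R by rewrite -mul2n exprM; congr (_ ^+ _); ring.
(* The cases are 2m+2 and 2m+1 children, both with the sum S_m; the first reduces to the second by
   C(2m+2, m+1) = 2 C(2m+1, m). *)
rewrite -(odd_double_half n); case: (odd n); move: n./2 => m;
  rewrite ?add0n ?add1n /= ?doubleK ?uphalf_double odd_case.
  rewrite bin_central -(mul2n 'C(_, _)) natrM exprS -pow4.
  by field; rewrite expf_neq0 // pnatr_eq0.
by rewrite -pow4.
Qed.

Lemma central_sum0 (R : fieldType) (m : nat) : central_sum m 0 = 1 :> R.
Proof.
rewrite /central_sum big_ord_recl big1 ?addr0 ?bin0 ?expr0 ?mulr1 // => i _.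
by rewrite mul0r expr0n mulr0.
Qed.

Lemma le_central_sum (R : numFieldType) (m : nat) (x y : R) :
  0 <= x -> x <= y -> central_sum m x <= central_sum m y.
Proof.
move=> x0 xy; apply: ler_sum => i _; apply: ler_wpM2l => //.
by rewrite lerXn2r ?nnegrE ?divr_ge0 ?ler_pM2r ?invr_gt0 // (le_trans x0).
Qed.

Lemma central_sum_ge1 (R : numFieldType) (m : nat) (x : R) :
  0 <= x -> 1 <= central_sum m x.
Proof. by move=> x0; rewrite -(central_sum0 R m) le_central_sum. Qed.

Lemma central_sum_gt1 (R : numFieldType) (m : nat) (x : R) :
  (0 < m)%N -> 0 < x -> 1 < central_sum m x.
Proof.
case: m => // m _ x0; rewrite central_sumS.
apply: (le_lt_trans (central_sum_ge1 R m x (ltW x0))); rewrite ltrDl.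
by rewrite mulr_gt0 ?exprn_gt0 ?divr_gt0 // ltr0n bin_gt0 -addnn leq_addr.
Qed.

Lemma continuous_central_sum (R : realType) (m : nat) :
  continuous (@central_sum R m).
Proof.
rewrite /central_sum; apply: continuous_big; first exact: add_continuous.
move=> i _ x; apply: cvgM; first exact: cvg_cst.
apply: (@continuous_comp _ _ _ (fun x : R => x / 4) (fun y => y ^+ i)).
  exact: mulrr_continuous.
exact: exprn_continuous.
Qed.

(** * The terms of the series for F + 1 *)

Lemma sum_majority_eta (R : realType) (n : nat) (W : nat -> R) : (0 < n)%N ->
  \sum_(1 <= k < n.+1) majority_eta R n k * W k =
  2^-1 * (W n.+1./2 + W (uphalf n.+1)).
Proof.
move=> n0.
have pick a : (1 <= a <= n)%N -> \sum_(1 <= k < n.+1) (k == a)%:R * W k = W a.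
  move=> an; rewrite (bigD1_seq a) ?mem_index_iota ?iota_uniq //= eqxx mul1r.
  by rewrite big1 ?addr0 // => k /negPf ->; rewrite mul0r.
rewrite -[W n.+1./2]pick -1?[W (uphalf _)]pick; [|lia..].
rewrite -big_split mulr_sumr; apply: eq_bigr => k _.
by rewrite /majority_eta -mulrA mulrDl.
Qed.

Definition majority_term {R : realType} (n : nat) (u : R) : R :=
  2 ^- n.-1 * (\sum_(1 <= k < n.+1)
    majority_eta R n k * binom_tail (1 + u) (1 - u) n k).

(** For n = 2m+2 the thresholds are m+1 and m+2, which is the tie situation; for n = 2m+1 both equal
    m+1. Either way the tail of 2m+1 voters at m+1 remains. *)
Lemma majority_termE (R : realType) (n : nat) (u : R) : (0 < n)%N ->
  majority_term n u = 1 + u * central_sum n.-1./2 (1 - u ^+ 2).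
Proof.
move=> n0; rewrite /majority_term sum_majority_eta //.
have pow4 m : 4 ^+ m = 2 ^+ m.*2 :> R by rewrite -mul2n exprM; congr (_ ^+ _); ring.
case: n n0 => // n _; rewrite -[n]odd_double_half.
case: (odd n); move: n./2 => m; rewrite ?add0n ?add1n /= ?doubleK ?uphalf_double.
  rewrite -doubleS binom_tail_tie binom_tail_majority exprS -pow4.
  by field; rewrite expf_neq0 // pnatr_eq0.
rewrite binom_tail_majority -pow4.
by field; rewrite expf_neq0 // pnatr_eq0.
Qed.

(** 1 + u S_m(1 - u^2) is twice the probability of a majority among 2m+1 voters, so it lies in
    [0, 2]. *)
Lemma normr_central_sum_le1 (R : realType) (m : nat) (u : R) :
  `|u| <= 1 -> `|u * central_sum m (1 - u ^+ 2)| <= 1.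
Proof.
rewrite ler_norml => /andP[u1 u2].
have u1' : 0 <= 1 + u by lra.
have u2' : 0 <= 1 - u by lra.
have /andP[] := binom_tail_bounds R _ _ m.*2.+1 m.+1 u1' u2'.
have pow4 : (1 + u + (1 - u)) ^+ m.*2.+1 = 4 ^+ m * 2 :> R.
  have -> : 1 + u + (1 - u) = 2 by ring.
  by rewrite exprSr -mul2n exprM; congr (_ ^+ _ * _); ring.
rewrite pow4 binom_tail_majority pmulr_rge0 ?exprn_gt0 // ler_pM2l ?exprn_gt0 //.
by rewrite ler_norml => ? ?; lra.
Qed.

(** * Convergence in the reals and in the extended reals *)

Lemma nneseries_cvg_fin (R : realType) (f : nat -> R) (m : nat) (s : R) :
  (forall n, (m <= n)%N -> 0 <= f n) ->
  (\sum_(m <= n <oo) (f n)%:E = s%:E)%E ->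
  (\sum_(m <= n < N) f n) @[N --> \oo] --> s.
Proof.
move=> f0 fs.
have cf : (\sum_(m <= n < N) (f n)%:E)%E @[N --> \oo] --> s%:E.
  by rewrite -fs; apply: is_cvg_nneseries => n mn _; rewrite lee_fin f0.
rewrite (_ : (fun N => _) = fine \o (fun N => \sum_(m <= n < N) (f n)%:E)%E).
  exact: fine_cvg.
by apply/funext => N /=; rewrite sumEFin.
Qed.

(** Convergence from below, stated so as to cover a finite limit and +oo at once: F'(0) may be
    either. *)
Lemma cvge_le_lt {T : Type} {G : set_system T} {FG : Filter G} (R : realType)
    (f : T -> \bar R) (l : \bar R) :
  (-oo < l)%E -> (\forall x \near G, (f x <= l)%E) ->
  (forall a : R, (a%:E < l)%E -> \forall x \near G, (a%:E < f x)%E) ->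
  f x @[x --> G] --> l.
Proof.
case: l => [l| |] // _ fl lf; last first.
  by apply/cvgeyPgt => a; apply: lf; rewrite ltry.
apply/fine_cvgP; split.
  have := lf (l - 1); rewrite lte_fin ltrBlDr ltrDl ltr01 => /(_ isT) lf1.
  near=> x; have fx1 : ((l - 1)%:E < f x)%E by near: x.
  have fx2 : (f x <= l%:E)%E by near: x.
  by case: (f x) fx1 fx2.
apply/cvgrPdist_lt => e e0.
have := lf (l - e); rewrite lte_fin ltrBlDr ltrDl e0 => /(_ isT) lfe.
near=> x; have fx1 : ((l - e)%:E < f x)%E by near: x.
have fx2 : (f x <= l%:E)%E by near: x.
move: fx1 fx2 => /=; case: (f x) => [r| |] //=; rewrite lte_fin lee_fin => ? ?.
by rewrite ger0_norm; lra.
Unshelve. all: by end_near. Qed.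

(** * The slope F(u) / u as an extended-real series *)

Section slope.
Variables (R : realType) (p : nat -> R).
Hypothesis hp : is_offspring_law p.

(** Extended-real because the value at u = 0, which will be F'(0), can be +oo. *)
Definition slope (u : R) : \bar R :=
  (\sum_(1 <= n <oo) (p n * central_sum n.-1./2 (1 - u ^+ 2))%:E)%E.

Let p_ge0 n : (1 <= n)%N -> 0 <= p n. Proof. exact: hp.1. Qed.

Let subr_sqr_ge0 (u : R) : `|u| <= 1 -> 0 <= 1 - u ^+ 2.
Proof. by move=> u1; rewrite subr_ge0 -real_normK ?num_real // exprn_ile1. Qed.

Let term_ge0 u n : `|u| <= 1 -> (1 <= n)%N ->
  0 <= p n * central_sum n.-1./2 (1 - u ^+ 2).
Proof.
move=> u1 n1; rewrite mulr_ge0 ?p_ge0 // (le_trans ler01) // central_sum_ge1 //.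
exact: subr_sqr_ge0.
Qed.

Lemma slope_ge0 u : `|u| <= 1 -> (0 <= slope u)%E.
Proof.
by move=> u1; apply: nneseries_ge0 => n n1 _; rewrite lee_fin term_ge0.
Qed.

Lemma slope_le u : `|u| <= 1 -> (slope u <= slope 0)%E.
Proof.
move=> u1; apply: lee_nneseries => n; first by move=> n1 _; rewrite lee_fin term_ge0.
(* Index 0 must be compared too, with [p 0] of unknown sign; both sides agree there since S_0 is
   constant. *)
move=> _; rewrite lee_fin; case: n => [|n].
  by rewrite /central_sum !big_ord1 !expr0.
apply: ler_wpM2l; first exact: p_ge0.
by apply: le_central_sum; [exact: subr_sqr_ge0|rewrite expr0n subr0 gerBl sqr_ge0].
Qed.

Lemma slope1 : slope 1 = 1%E.
Proof.
by rewrite -hp.2; apply: eq_eseriesr => n _; rewrite expr1n subrr central_sum0 mulr1.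
Qed.

Lemma slope_gt1 u n : `|u| < 1 -> (3 <= n)%N -> 0 < p n -> (1 < slope u)%E.
Proof.
move=> u1 n3 pn.
have u2 : 0 < 1 - u ^+ 2.
  by rewrite subr_gt0 -real_normK ?num_real // exprn_ilt1.
(* Subtracting the total mass 1 leaves a series of nonnegative terms, bounded below by its n-th
   term; that term is positive since n >= 3 gives S_m an index m >= 1. *)
pose g k := p k * (central_sum k.-1./2 (1 - u ^+ 2) - 1).
have g0 k : (1 <= k)%N -> 0 <= g k.
  by move=> k1; rewrite mulr_ge0 ?p_ge0 // subr_ge0 central_sum_ge1 // ltW.
have -> : slope u = (1 + \sum_(1 <= k <oo) (g k)%:E)%E.
  rewrite -hp.2 -nneseriesD => [||k k1 _]; last by rewrite lee_fin g0.
    by apply: eq_eseriesr => k _; rewrite -EFinD /g; congr EFin; ring.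
  by move=> k k1 _; rewrite lee_fin p_ge0.
rewrite lteDl //; apply: (@lt_le_trans _ _ (g n)%:E).
  by rewrite lte_fin mulr_gt0 // subr_gt0 central_sum_gt1 //; lia.
apply: (@le_trans _ _ (\sum_(1 <= k < n.+1) (g k)%:E)%E); last first.
  by apply: nneseries_lim_ge => k k1 _; rewrite lee_fin g0.
rewrite sumEFin lee_fin big_nat_recr /=; last by lia.
by rewrite lerDr big_nat sumr_ge0 // => k /andP[k1 _]; rewrite g0.
Qed.

Lemma slope_partial_gt (a : R) : (a%:E < slope 0)%E -> exists N,
  a < \sum_(1 <= n < N) p n * central_sum n.-1./2 (1 - 0 ^+ 2).
Proof.
move=> ha; apply/not_existsP => H; move: ha; apply/negP; rewrite -leNgt.
apply: lime_le.
  by apply: is_cvg_nneseries => n n1 _; rewrite lee_fin term_ge0 // normr0.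
by apply: nearW => N; rewrite sumEFin lee_fin leNgt; apply/negP/H.
Qed.

(** Monotone convergence: [slope 0] bounds from above, and for a below it some finite partial sum
    exceeds a at 0, hence by continuity near 0, where it bounds [slope h] from below. *)
Lemma slope_cvg0 : slope h @[h --> 0^'] --> slope 0.
Proof.
apply: cvge_le_lt.
- by rewrite (lt_le_trans ltNy0) // slope_ge0 // normr0.
- by near=> h; apply: slope_le; rewrite ltW //; near: h; exact: dnbhs0_lt.
move=> a /slope_partial_gt[N aN].
have cN : {for 0, continuous (fun h : R =>
    \sum_(1 <= n < N) p n * central_sum n.-1./2 (1 - h ^+ 2))}.
  apply: continuous_big; first exact: add_continuous.
  move=> n _ h; apply: cvgM; first exact: cvg_cst.
  apply: (@continuous_comp _ _ _ (fun x : R => 1 - x ^+ 2)).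
    by apply: cvgB; [exact: cvg_cst|exact: exprn_continuous].
  exact: continuous_central_sum.
near=> h; apply: (@lt_le_trans _ _
    (\sum_(1 <= n < N) p n * central_sum n.-1./2 (1 - h ^+ 2))%:E).
  rewrite lte_fin; near: h; apply: cvg_within; exact: cvgr_gt cN _ aN.
rewrite -sumEFin; apply: nneseries_lim_ge => n n1 _.
rewrite lee_fin term_ge0 // ltW //; near: h; exact: dnbhs0_lt.
Unshelve. all: by end_near. Qed.

Lemma branching_slope u : `|u| <= 1 ->
  ((branching_fun p (majority_eta R) u)%:E = u%:E * slope u)%E.
Proof.
move=> u1.
pose b N := \sum_(1 <= n < N) p n * central_sum n.-1./2 (1 - u ^+ 2).
have cp : (\sum_(1 <= n < N) p n) @[N --> \oo] --> (1 : R).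
  exact: nneseries_cvg_fin p_ge0 hp.2.
(* The real series for F + 1 splits into the mass of p and u times the partial sums [b N], so only
   the limit of the latter is at stake. *)
suff [L cL ->] : exists2 L : R, u * b N @[N --> \oo] --> L & (u%:E * slope u = L%:E)%E.
  rewrite /branching_fun; congr EFin.
  apply: (canLR (addrK _)); apply: cvg_lim => //.
  rewrite (_ : (fun N => _) = fun N => \sum_(1 <= n < N) p n + u * b N).
    by rewrite addrC; exact: cvgD cp cL.
  apply/funext => N; rewrite /b mulr_sumr -big_split /= !big_nat.
  apply: eq_bigr => n /andP[n1 _].
  have := majority_termE R n u n1; rewrite /majority_term => E.
  by rewrite mulrAC E; ring.
(* At u = 0 the slope may be +oo; the convention 0 * +oo = 0 matches the vanishing partial sums. *)
have [->|u0] := eqVneq u 0.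
  exists 0; last by rewrite mul0e.
  by under eq_fun do rewrite mul0r; exact: cvg_cst.
have su : slope u \is a fin_num.
  rewrite ge0_fin_numE ?slope_ge0 //.
  (* For u != 0 the bound |u S_m| <= 1 gives S_m <= 1/|u|, so the slope is at most 1/|u| because p
     has mass 1. *)
  apply: (@le_lt_trans _ _ (`|u|^-1)%:E); last exact: ltry.
  apply: lime_le.
    by apply: is_cvg_nneseries => n n1 _; rewrite lee_fin term_ge0.
  apply: nearW => N; rewrite sumEFin lee_fin.
  apply: (@le_trans _ _ (`|u|^-1 * \sum_(1 <= n < N) p n)).
    rewrite mulr_sumr !big_nat; apply: ler_sum => n /andP[n1 _].
    rewrite mulrC; apply: ler_wpM2r; first exact: p_ge0.
    rewrite -[leRHS]mul1r ler_pdivlMr ?normr_gt0 // mulrC.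
    apply: le_trans (normr_central_sum_le1 R n.-1./2 u u1).
    by rewrite normrM ler_wpM2l // ler_norm.
  rewrite -[leRHS]mulr1; apply: ler_wpM2l; first by rewrite invr_ge0.
  rewrite -lee_fin -sumEFin -hp.2; apply: nneseries_lim_ge => n n1 _.
  by rewrite lee_fin p_ge0.
exists (u * fine (slope u)); last by rewrite EFinM fineK.
apply: cvgM; first exact: cvg_cst.
by apply: nneseries_cvg_fin; [move=> n; exact: term_ge0|rewrite -/(slope u) fineK].
Qed.

Lemma diff_quotient_branching_cvg :
  diff_quotient (branching_fun p (majority_eta R)) 0 @ 0^' --> slope 0.
Proof.
apply: cvg_trans slope_cvg0; apply: near_eq_cvg; near=> h.
have h0 : h != 0 by near: h; exact: nbhs_dnbhs_neq.
have h1 : `|h| <= 1 by rewrite ltW //; near: h; exact: dnbhs0_lt.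
have F0 : branching_fun p (majority_eta R) 0 = 0.
  by apply: EFin_inj; rewrite branching_slope ?normr0 // mul0e.
rewrite /diff_quotient F0 addr0 subr0 EFinM branching_slope // muleA -EFinM.
by rewrite mulVf // mul1e.
Unshelve. all: by end_near. Qed.

End slope.

Theorem proposition1p7 (R : realType) (p : nat -> R)
    (hp : is_offspring_law p) :
  let F := branching_fun p (majority_eta R) in
  [/\ ederivable1 F 0,
      forall v : R, 0 <= v <= 1 -> ((F v)%:E <= ederive1 F 0 * v%:E)%E,
      ederive1 F 0 =
        (\sum_(1 <= n <oo)
           (p n * (2 ^- n.-1 * (uphalf n)%:R * 'C(n, n./2)%:R))%:E)%E
    & (exists n : nat, (3 <= n)%N /\ 0 < p n) ->
      (1 < ederive1 F 0)%E /\ Xi F = 1].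
Proof.
move=> F.
have cF := diff_quotient_branching_cvg R p hp.
have eF : ederive1 F 0 = slope R p 0 by exact: cvg_lim cF.
have FE := branching_slope R p hp.
split.
- by apply/cvg_ex; exists (slope R p 0).
- move=> v /andP[v0 v1]; rewrite eF FE ?ger0_norm // muleC.
  by apply: lee_wpmul2r; rewrite ?lee_fin // slope_le // ger0_norm.
- rewrite eF; apply: congr_lim; apply/funext => N.
  rewrite !big_nat; apply: eq_bigr => n /andP[n1 _].
  by rewrite expr0n subr0 central_sum1.
case=> n [n3 pn]; split.
  by rewrite eF; apply: (slope_gt1 R p hp 0 n) => //; rewrite normr0.
(* The set defining [Xi] is the singleton {1}: F(1) = 1 because [slope 1] is 1, while for 0 < v < 1
   a slope above 1 forces F(v) > v. *)
rewrite /Xi -[RHS]inf1; congr inf; apply/seteqP; split => v /=; last first.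
  by move=> ->; rewrite ltr01 lexx -lee_fin FE ?normr1 // slope1 // mule1.
case=> /andP[v0 v1] Fv; apply/eqP; rewrite eq_le v1 leNgt /=; apply/negP => vlt1.
move: Fv; apply/negP; rewrite -ltNge -lte_fin FE; last by rewrite gtr0_norm.
rewrite -[ltLHS]mule1 lte_pmul2l ?lte_fin //.
by apply: (slope_gt1 R p hp v n) => //; rewrite gtr0_norm.
Qed.
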